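(* The out-of-order membership problem for the language $a^*b^*a^*b^*a^*b^*$ over the alphabet $\{a,b\}$ has $O(\sqrt n)$ space complexity.
   Context: Problem. Let $\Sigma$ be a finite alphabet, let $w=w[1]\cdots w[n]$ be a word of length $n>0$ over $\Sigma$ and let $\pi$ be a permutation of $\{1,\ldots,n\}$. The out-of-order stream of $w$ defined by $\pi$ is the sequence of triples $(w[\pi(i)],\pi(i),n)$ for $i=1,\ldots,n$. In the out-of-order membership problem for a fixed language $L\subseteq\Sigma^*$, the algorithm receives the triples one after the other, for arbitrary $w$ and arbitrary $\pi$, and must decide at the end whether $w\in L$. The length $n$ is known and not counted in the space. Space. Algorithms are deterministic, and only the bits memorized between two consecutive stream elements are counted (computation time and interim memory used while processing an element are ignored). Formally, an algorithm using $s(n)$ bits consists, for each $n\ge 1$, of a set $Q_n$ of memory states with $|Q_n|\le 2^{s(n)}$, an initial state, an update function $Q_n\times\Sigma\times\{1,\ldots,n\}\to Q_n$, and an output function $Q_n\to\{\text{yes},\text{no}\}$, such that for every $w\in\Sigma^n$ and every permutation $\pi$ the output after processing the stream is correct. The problem has $O(g(n))$ space complexity if some algorithm uses $s(n)=O(g(n))$ bits. *)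

(* Defs.v *)
From mathcomp Require Import all_boot all_order all_algebra all_fingroup.
From mathcomp Require Import boolp classical_sets filter reals topology normedtype landau.

Set Implicit Arguments.
Unset Strict Implicit.
Unset Printing Implicit Defensive.

Import Order.TTheory GRing.Theory Num.Theory numFieldNormedType.Exports.

Local Open Scope classical_set_scope.

(* Positions are numbered from 0: ['I_n] stands for {1, ..., n}. *)
Record ooo_algorithm (Sigma : finType) (n : nat) := OOOAlgorithm {
  state : finType;
  init : state;
  update : state -> Sigma * 'I_n -> state;
  output : state -> bool }.

(* The third component of the triples (w[pi(i)], pi(i), n) is omitted: an
   algorithm is chosen for each length, so it already knows n. *)
Definition ooo_stream (Sigma : finType) (n : nat) (w : n.-tuple Sigma)
    (pi : 'S_n) : seq (Sigma * 'I_n) :=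
  [seq (tnth w (pi i), pi i) | i <- enum 'I_n].

Definition run (Sigma : finType) (n : nat) (A : ooo_algorithm Sigma n)
    (s : seq (Sigma * 'I_n)) : bool :=
  output (foldl (@update _ _ A) (init A) s).

Definition decides (Sigma : finType) (L : seq Sigma -> Prop) (n : nat)
    (A : ooo_algorithm Sigma n) : Prop :=
  forall (w : n.-tuple Sigma) (pi : 'S_n), run A (ooo_stream w pi) <-> L w.

Definition ooo_membership_in_space (Sigma : finType) (L : seq Sigma -> Prop)
    (s : nat -> nat) : Prop :=
  exists A : forall n : nat, ooo_algorithm Sigma n,
    forall n : nat, (0 < n)%N ->
      (#|state (A n)| <= 2 ^ s n)%N /\ decides L (A n).

Definition ooo_membership_space_bigO (R : realType) (Sigma : finType)
    (L : seq Sigma -> Prop) (g : nat -> R) : Prop :=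
  exists2 s : nat -> nat, ooo_membership_in_space L s &
    (fun n : nat => (s n)%:R%R : R) =O_\oo g.

(* The two-letter alphabet {a, b} is [bool]. *)
Definition letter_a : bool := false.
Definition letter_b : bool := true.

Definition lang_ababab (w : seq bool) : Prop :=
  exists k1 k2 k3 k4 k5 k6 : nat,
    w = nseq k1 letter_a ++ nseq k2 letter_b ++ nseq k3 letter_a
        ++ nseq k4 letter_b ++ nseq k5 letter_a ++ nseq k6 letter_b.

(* Main.v *)
(** A word of the language has at most five block boundaries, so some integer
    polynomial of degree 5 is positive exactly at its b's and negative exactly
    at its a's.  If another word has the same power sums of b-positions up to
    degree 5, then summing this polynomial against the difference of the two
    indicator functions gives 0, although every term is nonnegative; hence the
    words are equal.  So it suffices to maintain these six power sums, which
    takes O(log n) bits and is insensitive to the order of the stream. *)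
Require Import Defs.
From mathcomp Require Import all_boot all_order all_algebra all_fingroup.
From mathcomp Require Import reals boolp filter topology normedtype landau.
From mathcomp Require Import zify ring lra.

Set Implicit Arguments.
Unset Strict Implicit.
Unset Printing Implicit Defensive.

Import Order.TTheory GRing.Theory Num.Theory numFieldNormedType.Exports.

Local Open Scope ring_scope.

(** The state is the running sum of the values of [c], which by commutativity does not depend on
    [pi]. The output asks whether some word of [L] has this sum, and the hypothesis makes that
    answer correct. *)
Lemma decides_of_additive_invariant (Sigma : finType) (L : seq Sigma -> Prop)
    (n : nat) (V : finZmodType) (c : Sigma * 'I_n -> V) :
  (forall w w' : n.-tuple Sigma,
     \sum_i c (tnth w i, i) = \sum_i c (tnth w' i, i) -> L w -> L w') ->
  exists2 A : ooo_algorithm Sigma n, #|state A| = #|V| & decides L A.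
Proof.
move=> cL.
exists (@OOOAlgorithm _ _ V 0 (fun v x => v + c x)
  (fun v => `[< exists2 w : n.-tuple Sigma, L w & \sum_i c (tnth w i, i) = v >])).
  by [].
move=> w pi; rewrite /run /=.
have foldlE (s : seq (Sigma * 'I_n)) v :
    foldl (fun v x => v + c x) v s = v + \sum_(x <- s) c x.
  elim: s v => [|x s IHs] v /=; first by rewrite big_nil addr0.
  by rewrite IHs big_cons addrA.
rewrite foldlE add0r /ooo_stream big_map big_enum /=.
rewrite -(reindex_inj (@perm_inj _ pi) (P := predT)
  (F := fun i => c (tnth w i, i))).
split=> [/asboolP[w' Lw' Ew']|Lw]; first exact: cL Ew' Lw'.
by apply/asboolP; exists w.
Qed.

Definition signed (c : bool) (x : int) : int := if c then x else - x.

(* The condition at negative points only serves the induction: in [nseq k c ++ u]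
   the polynomial of [u], shifted by [k], is also evaluated to the left of [u]. *)
Definition separating (c : bool) (u : seq bool) (p : {poly int}) : Prop :=
  (forall x : int, x < 0 -> 0 < signed c p.[x]) /\
  (forall i : nat, (i < size u)%N -> 0 < signed (nth false u i) p.[i%:Z]).

Lemma separating_nseq (c : bool) (k : nat) :
  exists2 p : {poly int}, (size p <= 1)%N & separating c (nseq k c) p.
Proof.
exists (signed c 1)%:P; first exact: size_polyC_leq1.
split=> [x _|i]; first by rewrite hornerC; case: c.
by rewrite size_nseq hornerC nth_nseq => ->; case: c.
Qed.

Lemma separating_cat (c : bool) (k d : nat) (u : seq bool) :
  (exists2 p : {poly int}, (size p <= d)%N & separating (~~ c) u p) ->
  exists2 p : {poly int}, (size p <= d.+1)%N & separating c (nseq k c ++ u) p.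
Proof.
case=> p szp [pneg ppos].
(* The root k - 1/2 lies strictly between the last position of the new block and the first of [u].
   The factor flips the sign of the shifted [p] left of k, keeps it from k on, and vanishes at no
   integer. *)
pose l : {poly int} := 2%:P * 'X + (1 - 2 * k%:Z)%:P.
have lE (x : int) : l.[x] = 2 * (x - k%:Z) + 1.
  by rewrite /l hornerD hornerM !hornerC hornerX; ring.
pose q := (p \Po ('X - k%:Z%:P)) * l.
have qE (x : int) : q.[x] = p.[x - k%:Z] * (2 * (x - k%:Z) + 1).
  by rewrite /q hornerM horner_comp lE hornerXsubC.
have qneg (x : int) : x < k%:Z -> 0 < signed c q.[x].
  move=> xk; rewrite qE; have {}xk : x - k%:Z < 0 by rewrite subr_lt0.
  have := pneg _ xk; rewrite /signed.
  by move: (x - k%:Z) xk => y; move: p.[y] => a; case: (c) => /=; nia.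
exists q.
  apply: leq_trans (size_polyMleq _ _) _.
  rewrite size_comp_poly2 ?size_XsubC //.
  have : (size l <= 2)%N.
    rewrite (leq_trans (size_polyD _ _)) // geq_max mul_polyC.
    by rewrite (leq_trans (size_scale_leq _ _)) ?size_polyX // leqW ?size_polyC_leq1.
  by move=> szl; rewrite -[d.+1]/d.+2.-1 -addn2 -!subn1 leq_sub2r // leq_add.
split=> [x x0|i]; first by apply: qneg; lia.
rewrite size_cat size_nseq nth_cat size_nseq nth_nseq => ik.
case: ltnP => ki; first by apply: qneg; rewrite ltz_nat.
have : (i - k < size u)%N by lia.
by move/ppos; rewrite qE -subzn //; move: p.[i%:Z - _] => a; case: nth => /=; nia.
Qed.

Lemma lang_ababab_separating (w : seq bool) : lang_ababab w ->
  exists2 p : {poly int}, (size p <= 6)%N & separating letter_a w p.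
Proof.
case=> k1 [k2 [k3 [k4 [k5 [k6 ->]]]]].
by do 5!apply: separating_cat; apply: separating_nseq.
Qed.

Definition moment (n : nat) (w : n.-tuple bool) (k : nat) : nat :=
  \sum_(i < n) tnth w i * i ^ k.

Lemma moment_ub (n : nat) (w : n.-tuple bool) (k : nat) :
  (moment w k <= n ^ k.+1)%N.
Proof.
apply: (@leq_trans (\sum_(i < n) n ^ k)%N); last first.
  by rewrite sum_nat_const card_ord expnS.
apply: leq_sum => i _; rewrite -[leqRHS]mul1n leq_mul ?leq_b1 //.
case: k => [//|k]; by rewrite leq_exp2r // ltnW.
Qed.

Lemma sum_horner_moment (n d : nat) (w : n.-tuple bool) (p : {poly int}) :
  (size p <= d)%N ->
  \sum_(i < n) (tnth w i)%:R * p.[i%:Z] = \sum_(k < d) p`_k * (moment w k)%:Z.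
Proof.
move=> szp.
under eq_bigr => i _ do rewrite (horner_coef_wide _ szp) mulr_sumr.
rewrite exchange_big; apply: eq_bigr => k _.
rewrite /moment -natz natr_sum mulr_sumr; apply: eq_bigr => i _.
by rewrite natrM natrX !natz; ring.
Qed.

Lemma separating_moment_inj (n d : nat) (c : bool) (w w' : n.-tuple bool)
    (p : {poly int}) :
  (size p <= d)%N -> separating c w p ->
  (forall k, (k < d)%N -> moment w k = moment w' k) -> w = w'.
Proof.
move=> szp [_ sep] Ew.
have p_gt0 (i : 'I_n) : 0 < signed (tnth w i) p.[i%:Z].
  by rewrite (tnth_nth false); apply: sep; rewrite size_tuple.
pose F (i : 'I_n) : int := ((tnth w i)%:R - (tnth w' i)%:R) * p.[i%:Z].
have F_ge0 (i : 'I_n) : true -> 0 <= F i.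
  by move=> _; rewrite /F; have := p_gt0 i; rewrite /signed; case: (tnth w i); case: (tnth w' i) => /=; lia.
have sumF0 : \sum_i F i = 0.
  under eq_bigr => i _ do rewrite /F mulrBl.
  rewrite sumrB !(sum_horner_moment _ szp); apply/eqP; rewrite subr_eq0.
  by apply/eqP; apply: eq_bigr => k _; rewrite Ew.
(* Since [p] is nonzero at each position, a zero term forces equal letters. *)
apply: eq_from_tnth => i.
have := psumr_eq0P F_ge0 sumF0 (i := i) isT; have := p_gt0 i.
by rewrite /F; rewrite /signed; case: (tnth w i); case: (tnth w' i) => //=; lia.
Qed.

(* The six power sums are below [2 ^ (6 * l)], so they can be kept modulo it. *)
Lemma lang_ababab_algorithm (n l : nat) : (0 < l)%N -> (n < 2 ^ l)%N ->
  exists2 A : ooo_algorithm bool n,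
    #|state A| = (2 ^ (36 * l))%N & decides lang_ababab A.
Proof.
move=> l_gt0 n_lt; pose M := (2 ^ (6 * l))%N.
(* ['Z_M] always has at least two elements, so it is the ring of residues modulo M only for M >
   1. *)
have M_gt1 : (1 < M)%N by rewrite -[1%N](expn0 2) ltn_exp2l // muln_gt0.
pose c (x : bool * 'I_n) : 'rV['Z_M]_6 := \row_k (x.1 * x.2 ^ k)%:R.
have sum_c (w : n.-tuple bool) (k : 'I_6) :
    (\sum_i c (tnth w i, i)) 0 k = (moment w k)%:R.
  by rewrite summxE natr_sum; apply: eq_bigr => i _; rewrite mxE.
have moment_lt (w : n.-tuple bool) (k : 'I_6) : (moment w k < M)%N.
  apply: leq_ltn_trans (moment_ub w k) _.
  rewrite /M mulnC expnM; apply: (@leq_ltn_trans (n ^ 6)); last by rewrite ltn_exp2r.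
  by case: (posnP n) => [->|n_gt0]; rewrite ?exp0n ?leq_pexp2l.
have [|A cardA decA] := @decides_of_additive_invariant _ lang_ababab n _ c.
  move=> w w' Ew Lw; have [p szp sep] := lang_ababab_separating Lw.
  suff <- : w = w' by [].
  apply: (separating_moment_inj szp sep) => k k_lt.
  have /(congr1 val) := congr1 (fun v : 'rV_6 => v 0 (Ordinal k_lt)) Ew.
  by rewrite !sum_c /= !val_Zp_nat // !modn_small //; apply: (moment_lt _ (Ordinal k_lt)).
exists A => //.
(* Six residues of 6l bits each give 36l bits. *)
by rewrite cardA card_mx card_ord Zp_cast // mul1n -expnM; congr (_ ^ _)%N; lia.
Qed.

Lemma trunc_log_le_sqrt (R : realType) (n : nat) : (0 < n)%N ->
  (trunc_log 2 n).+1%:R <= 2 * Num.sqrt (n%:R : R).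
Proof.
move=> n_gt0.
(* Doubling the right side suffices once (m+2)^2 <= 2(m+1)^2, that is from m = 2 on; smaller cases
   are computed. *)
have sqr_le m : (m.+1 ^ 2 <= 4 * 2 ^ m)%N.
  rewrite -mulnn; elim: m => [//|[//|[//|m]] IHm].
  by rewrite (expnS 2 m.+2); move: (2 ^ m.+2)%N IHm => e; nia.
have : ((trunc_log 2 n).+1 ^ 2 <= 4 * n)%N.
  by apply: leq_trans (sqr_le _) _; rewrite leq_mul2l trunc_logP.
rewrite -(ler_nat R) natrX natrM => /ler_wsqrtr.
rewrite sqrtr_sqr normr_nat sqrtrM //.
by rewrite (natrX R 2 2) sqrtr_sqr normr_nat.
Qed.

Theorem proposition5p3 (R : realType) :
  ooo_membership_space_bigO lang_ababab
    (fun n : nat => Num.sqrt (n%:R : R))%R.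
Proof.
exists (fun n => 36 * (trunc_log 2 n).+1)%N.
  have alg n : exists2 A : ooo_algorithm bool n,
      #|state A| = (2 ^ (36 * (trunc_log 2 n).+1))%N & decides lang_ababab A.
    by apply: lang_ababab_algorithm => //; apply: trunc_log_ltn.
  exists (fun n => sval (cid2 (alg n))) => n _.
  by case: cid2 => A /= -> ?.
(* 72 is 36 times the factor 2 of [trunc_log_le_sqrt]. *)
apply/eqO_exP; exists 72 => //.
near=> n.
have n_gt0 : (0 < n)%N by near: n; exact: nbhs_infty_gt.
rewrite normr_nat ger0_norm ?sqrtr_ge0 // natrM.
by have := trunc_log_le_sqrt R n_gt0; lra.
Unshelve. all: by end_near.
Qed.
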